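(* Let $K$ be a field with $\mathrm{char}(K)\neq 2$, let $X=\{x_1,x_2,\ldots\}$ be a finite or countable set with $|X|\geq 5$, and let $S$ be the subsemigroup of $\mathrm{End}(K\langle X\rangle)$ generated by all endomorphisms sending $x_1,x_2,x_3,x_4$ to arbitrary elements of $X$ (allowing repetitions) and $x_5$ to products of the form $x_1^{a_1}\cdots x_m^{a_m}$, $a_i\geq 0$. Then the polynomials \[ [[x_1,x_2],x_3],\quad [x_1,x_2]x_5[x_3,x_4]+[x_1,x_3]x_5[x_2,x_4] \] form a (nonminimal) Gröbner $S$-basis, with respect to the deg-lex ordering, of the T-ideal of $K\langle X\rangle$ generated by $[x_1,x_2,x_3]$.
   Context: $K\langle X\rangle$ is the free unitary associative $K$-algebra on $X$; $\langle X\rangle$ is its set of words (monomials); $\mathrm{End}(K\langle X\rangle)$ is the semigroup of all its $K$-algebra endomorphisms. $[f,g]=fg-gf$ and $[f,g,h]=[[f,g],h]$. The T-ideal of $K\langle X\rangle$ generated by $[x_1,x_2,x_3]$ is the two-sided ideal generated by all $[f_1,f_2,f_3]$ with $f_1,f_2,f_3\in K\langle X\rangle$. In the description of $S$, $m$ is any index with $x_1,\ldots,x_m\in X$, and no condition is imposed on the images of the variables $x_i$ with $i>5$. Deg-lex ordering on $\langle X\rangle$: monomials are compared first by total degree and then lexicographically, reading from left to right, with $x_1<x_2<\cdots$. For nonzero $f\in K\langle X\rangle$, $\mathrm{lt}(f)$ is the greatest monomial occurring in $f$ (with nonzero coefficient). A subset $G$ of a two-sided ideal $I$ is a Gröbner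 basis of $I$ if for every nonzero $f\in I$ there is a (nonzero) $g\in G$ such that $\mathrm{lt}(g)$ is a subword (contiguous factor) of $\mathrm{lt}(f)$. A Gröbner basis $G$ of $I$ is minimal if for every $g\in G$ the set $G\setminus\{g\}$ is not a Gröbner basis of $I$. For a semigroup $S$ of endomorphisms of $K\langle X\rangle$ containing the identity, an $S$-ideal is a two-sided ideal $I$ with $\varphi(I)\subset I$ for all $\varphi\in S$. A subset $G\subset I$ of an $S$-ideal $I$ is a Gröbner $S$-basis of $I$ if $S(G)=\{\varphi(g)\mid\varphi\in S,\ g\in G\}$ is a Gröbner basis of $I$ as a two-sided ideal. ''Nonminimal'' means that the Gröbner basis $S(G)$ is not minimal. *)

(* Defs.v *)
From HB Require Import structures.
From mathcomp Require Import all_boot all_order all_algebra.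
From mathcomp Require Import finmap.
From mathcomp Require Import monalg.
From mathcomp Require Import classical_sets.

Set Implicit Arguments.
Unset Strict Implicit.
Unset Printing Implicit Defensive.

Import Order.TTheory GRing.Theory.

Local Open Scope classical_set_scope.
Local Open Scope ring_scope.

(** The alphabet X = {x_1, x_2, ...}, with 1-based indices: [N = Some n] stands
    for X = {x_1, ..., x_n} and [N = None] for the countably infinite X. *)
Definition in_alphabet (N : option nat) (i : nat) : bool :=
  (0 < i)%N && (if N is Some n then (i <= n)%N else true).

Record alphabet (N : option nat) := Alphabet {
  index_of :> nat;
  _ : in_alphabet N index_of
}.

HB.instance Definition _ N := [isSub for @index_of N].
HB.instance Definition _ N := [Countable of alphabet N by <:].

Notation word N := {fmonom (alphabet N)}.

(** K<X>, as the monoid algebra of the free monoid on X. *)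
Notation free_algebra K N := {malg K[{fmonom (alphabet N)}]}.

Notation endo K N := {lrmorphism free_algebra K N -> free_algebra K N}.

Definition letter (K : fieldType) (N : option nat) (j : alphabet N) :
  free_algebra K N := << fmu j >>.

(** x_i; the value 0 for an index outside the alphabet is a dummy. *)
Definition var (K : fieldType) (N : option nat) (i : nat) : free_algebra K N :=
  if (insub i : option (alphabet N)) is Some j then letter K j else 0.

Section DegLex.
Variable N : option nat.
Implicit Types u v w : word N.

Definition deglex u v : bool :=
  (size u < size v)%N ||
  (size u == size v) &&
    ((map (@index_of N) u : seqlexi nat) <= (map (@index_of N) v : seqlexi nat))%O.

Lemma deglex_refl : reflexive deglex.
Proof. by move=> u; rewrite /deglex eqxx lexx orbT. Qed.

Lemma deglex_total : total deglex.
Proof.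
move=> u v; rewrite /deglex [size v == _]eq_sym.
by case: (ltngtP (size u) (size v)) => //= _; exact: le_total.
Qed.

Lemma deglex_anti : antisymmetric deglex.
Proof.
move=> u v; rewrite /deglex [size v == _]eq_sym.
case: (ltngtP (size u) (size v)) => //= _ /le_anti/(inj_map val_inj) uv.
exact: val_inj.
Qed.

Lemma deglex_trans : transitive deglex.
Proof.
move=> v u w; rewrite /deglex.
case: (ltngtP (size u) (size v)) => //= [uv|uv].
  move=> _ /orP[vw|/andP[/eqP <- _]]; last by rewrite uv.
  by rewrite (ltn_trans uv vw).
rewrite uv => leuv; case/orP => [-> //|/andP[-> levw]].
by rewrite (le_trans leuv levw) orbT.
Qed.

Lemma deglex_nil w : deglex mone w.
Proof.
rewrite /deglex fm1 /=.
by case: (fmonom_val w).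
Qed.

Definition deglex_max u v : word N := if deglex u v then v else u.

End DegLex.

Section GroebnerBases.
Variables (K : fieldType) (N : option nat).
Local Notation A := (free_algebra K N).
Implicit Types (f g h : A) (G I : set A) (S : set (endo K N)).

(** lt(f). The value for f = 0 is the empty word, a dummy: every use below is
    guarded by nonzeroness. *)
Definition lmonom f : word N := \big[@deglex_max N/mone]_(w <- msupp f) w.

Lemma lmonomP f : f != 0 ->
  lmonom f \in msupp f /\ {in msupp f, forall w, deglex w (lmonom f)}.
Proof.
rewrite -msupp_eq0 /lmonom => f0.
have [w0 w0f] : exists w, w \in msupp f by apply/fset0Pn.
have : (msupp f : seq (word N)) != [::].
  by apply/eqP => f_nil; move: w0f; rewrite -[_ \in _]/(w0 \in (msupp f : seq _)) f_nil.
suff sP (s : seq (word N)) : s != [::] ->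
    \big[@deglex_max N/mone]_(w <- s) w \in s /\
    {in s, forall w, deglex w (\big[@deglex_max N/mone]_(v <- s) v)} by move=> /sP.
elim: s => //= u s IHs _; rewrite big_cons /deglex_max.
have [->|s0] := eqVneq s [::].
  rewrite big_nil; case: ifPn => [u1|_].
    have -> : u = mone by apply: deglex_anti; rewrite u1 deglex_nil.
    by rewrite inE eqxx; split => // w; rewrite inE => /eqP ->; apply: deglex_refl.
  by rewrite inE eqxx; split => // w; rewrite inE => /eqP ->; apply: deglex_refl.
have [ls sP] := IHs s0; case: ifPn => [ul|ul]; rewrite inE ?eqxx ?ls ?orbT.
  by split=> // w; rewrite inE => /predU1P[->//|/sP].
split=> // w; rewrite inE => /predU1P[->|/sP wl]; first exact: deglex_refl.
apply: deglex_trans wl _.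
by have := deglex_total u (\big[@deglex_max N/mone]_(j <- s) j); rewrite (negPf ul).
Qed.

Definition two_sided_ideal I : Prop :=
  [/\ I 0, forall f g, I f -> I g -> I (f + g)
    & forall f g h, I g -> I (f * g * h)].

Definition groebner_basis I G : Prop :=
  [/\ two_sided_ideal I, G `<=` I
    & forall f, I f -> f != 0 ->
        exists g, [/\ G g, g != 0 & infix (lmonom g) (lmonom f)]].

Definition minimal_groebner_basis I G : Prop :=
  groebner_basis I G /\ forall g, G g -> ~ groebner_basis I (G `\ g).

Definition subsemigroup S : Prop :=
  forall phi psi : endo K N, S phi -> S psi -> S (phi \o psi : endo K N).

Definition S_ideal S I : Prop :=
  [/\ subsemigroup S, S (idfun : endo K N), two_sided_ideal I
    & forall phi : endo K N, S phi -> phi @` I `<=` I].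

Definition S_image S G : set A := [set phi g | phi in S & g in G].

Definition groebner_S_basis S I G : Prop :=
  [/\ S_ideal S I, G `<=` I & groebner_basis I (S_image S G)].

Definition commutator f g : A := f * g - g * f.

(** The T-ideal generated by [x_1, x_2, x_3]. *)
Definition T_ideal_comm3 : set A :=
  smallest two_sided_ideal
    [set f | exists f1 f2 f3, f = commutator (commutator f1 f2) f3].

(** No condition is put on the images of x_6, x_7, ... *)
Definition S_generator (phi : endo K N) : Prop :=
  (forall i, (1 <= i <= 4)%N ->
     exists j : alphabet N, phi (var K N i) = letter K j) /\
  (exists (m : nat) (a : nat -> nat),
     (forall i, (1 <= i <= m)%N -> in_alphabet N i) /\
     phi (var K N 5) = \prod_(1 <= i < m.+1) var K N i ^+ a i).

Definition S_endo : set (endo K N) :=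
  smallest subsemigroup [set phi | S_generator phi].

End GroebnerBases.

(* Main.v *)
From HB Require Import structures.
Require Import Defs.
From mathcomp Require Import all_boot all_order all_algebra.
From mathcomp Require Import finmap.
From mathcomp Require Import monalg.
From mathcomp Require Import classical_sets.

(** Modulo the T-ideal T generated by [x_1, x_2, x_3], every commutator is
    central and [a, b] e [c, d] is antisymmetric in a, b, c, d. Both polynomials
    of the basis are therefore in T ([T_ideal_latyshev]), as are their images
    under every endomorphism. What has to be shown is that the leading monomial
    of each nonzero element of T has a factor which is the leading monomial of
    an element of S(G).

    On the one hand, S(G) contains [[a, b], c] and [a, b] q [c, d] + [a, c] q [b, d]
    for all letters a, b, c, d and all nondecreasing words q. A suitable choice
    of the letters makes leading monomials of the words a a c and a b c with
    b, c < a, and of the words x y q z t with y < x, t < z and t <= x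
    ([obstruction_S_image]). A word without such a factor is normal:
    it is built from a nondecreasing word by inserting isolated descents
    x_1 > y_1, ..., x_k > y_k with y_1 < x_1 < y_2 < x_2 < ... at the places
    that the letters x_j determine ([normal_or_obstruction]). Normal words
    correspond in this way to the elements
    x_1^a_1 ... x_m^a_m [x_i1, x_i2] ... [x_i(2k-1), x_i(2k)] with
    i1 < ... < i(2k), the known basis of the quotient by T.

    On the other hand, no nonzero element of T has a normal leading monomial
    ([T_ideal_lmonom_not_normal]). Map x_i to t_i (1 + e_i), with commuting
    variables t_i and anticommuting elements e_i of square zero. The image lies
    in a supercommutative algebra, where the commutator of two elements is
    twice the product of their odd parts, hence even and central: the map kills
    T ([grassmann_image_T_ideal]). The variables t_i separate words of
    different contents, so it remains to find, for each normal word w, a linear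
    form that is nonzero at the product of the 1 + e_i along w and zero at the
    same product along each smaller rearrangement of w
    ([normal_word_independent]). With x y the first descent of w and c the number
    of letters y in w, this form extracts the part of degree one in e_x and in e_y
    of the product by (1 + e_y)^-c, and continues with the word after that descent.
    Indeed (1 + e_y)^-1 (1 + e_x) (1 + e_y) = 1 + e_x + 2 e_x e_y has such a part
    as 2 is invertible, whereas in a smaller rearrangement which differs from w
    before the end of that descent all the y come before the letters that are
    at least x, so that all the factors 1 + e_y can be cancelled. *)

Set Implicit Arguments.
Unset Strict Implicit.
Unset Printing Implicit Defensive.

Import Order.TTheory GRing.Theory.

Local Open Scope classical_set_scope.
Local Open Scope ring_scope.

(** * Normal words and their smaller rearrangements *)

(** The descents x > y of a normal word w are isolated and increase along w: the
    letters before x are smaller than x, the letters after y are at least x, and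
    the next descent lies above x altogether. The index b bounds from below the
    smaller letter of the first descent; it makes this last condition
    inductive. It does not bound the letters of the nondecreasing prefix p. *)
Inductive normal_word : nat -> seq nat -> Prop :=
| NormalSorted b w : sorted leq w -> normal_word b w
| NormalDescent b p x y w :
    sorted leq p -> all (fun i => i < x)%N p -> (b < y < x)%N ->
    all (leq x) w -> normal_word x w -> normal_word b (p ++ x :: y :: w).

Lemma sorted_lexi_min (w v : seq nat) :
  sorted leq w -> perm_eq v w -> (v <= w :> seqlexi nat)%O -> v = w.
Proof.
elim: w v => [|a w IHw] v; first by move=> _ /perm_nilP ->.
case: v => [|c v]; first by move=> _ /perm_size.
move=> srt pvw; rewrite lexi_cons => /andP[ca lvw].
have /andP[aw _] : all (leq a) w && sorted leq w.
  by move: srt; rewrite /= (path_sortedE leq_trans).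
have ac : (a <= c)%N.
  have : c \in a :: w by rewrite -(perm_mem pvw) mem_head.
  by rewrite inE => /predU1P[->//|/(allP aw)].
have eca : c = a by apply/eqP; rewrite eqn_leq ac andbT.
move: lvw pvw; rewrite eca /= lexx perm_cons => lvw pvw.
by rewrite (IHw v (path_sorted srt)).
Qed.

(** A rearrangement v of p x y w which is not larger either starts with p x y, or
    is smaller before that point. In the second case it has spent there its last
    copy of y, the only letter of the remaining ones that is small enough, so all
    its copies of y come before its letters that are at least x. *)
Lemma lexi_descent_dichotomy p x y w v :
  sorted leq p -> all (fun i => i < x)%N p -> (y < x)%N -> all (leq x) w ->
  perm_eq v (p ++ x :: y :: w) -> (v <= p ++ x :: y :: w :> seqlexi nat)%O ->
  (exists v1 v2, [/\ v = v1 ++ v2, all (fun i => i < x)%N v1 & y \notin v2]) \/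
  (exists v', [/\ v = p ++ x :: y :: v', perm_eq v' w
                & (v' <= w :> seqlexi nat)%O]).
Proof.
move=> srt px yx xw; have yNw : y \notin w.
  by apply/negP => /(allP xw) /=; rewrite leqNgt yx.
elim: p srt px v => [_ _|a p IHp srt /= /andP[ax px]] [|c v] //.
- by move=> /perm_size.
- move=> pv; rewrite lexi_cons => /andP[cx lv].
  have : c \in x :: y :: w by rewrite -(perm_mem pv) mem_head.
  rewrite !inE orbCA => /predU1P[cy|cxw].
    left; exists [:: c], v; split=> //; first by rewrite /= cy yx.
    have : count_mem y (c :: v) = count_mem y (x :: y :: w) by apply/permP.
    rewrite /= cy eqxx (gtn_eqF yx) (count_memPn yNw) add0n addn0.
    by rewrite -has_pred1 has_count; case: (count _ v).
  have ecx : c = x.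
    apply/eqP; rewrite eqn_leq; move: cx cxw; rewrite -leEnat => -> /=.
    by case/predU1P=> [->//|/(allP xw)].
  move: pv lv; rewrite ecx perm_cons lexx /= => pv lv.
  case: v pv lv => [/perm_size//|d v] pv; rewrite lexi_cons => /andP[dy lv].
  have : d \in y :: w by rewrite -(perm_mem pv) mem_head.
  rewrite inE => /predU1P[edy|/(allP xw) /= xd]; last first.
    by move: dy; rewrite leEnat leqNgt (leq_trans yx xd).
  right; exists v; rewrite edy in pv lv *; split=> //.
    by move: pv; rewrite perm_cons.
  by move: lv; rewrite lexx.
- by move=> /perm_size.
move=> pv; rewrite lexi_cons => /andP[ca lv].
have /andP[ap srtp] : all (leq a) p && sorted leq p.
  by move: srt; rewrite /= (path_sortedE leq_trans).
have [eca|nca] := eqVneq c a.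
  move: pv lv; rewrite eca perm_cons lexx /= => pv lv.
  case: (IHp srtp px v pv lv) => [[v1 [v2 [-> xv1 yv2]]]|[v' [-> pv' lv']]].
    by left; exists (a :: v1), v2; rewrite /= ax.
  by right; exists v'.
have lca : (c < a)%N by rewrite ltn_neqAle nca.
have cy : c = y.
  have : c \in a :: p ++ x :: y :: w by rewrite -(perm_mem pv) mem_head.
  rewrite inE (negPf nca) mem_cat !inE /= => /or4P[/(allP ap)|/eqP cx|/eqP//|].
  - by rewrite leqNgt lca.
  - by move: lca; rewrite cx ltnNge (ltnW ax).
  by move=> /(allP xw); rewrite leqNgt (ltn_trans lca ax).
left; exists [:: c], v; split=> //; first by rewrite /= cy yx.
have : count_mem y (c :: v) = count_mem y (a :: p ++ x :: y :: w) by apply/permP.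
rewrite /= count_cat /= cy eqxx (gtn_eqF yx) (count_memPn yNw).
have -> : (a == y) = false by rewrite -cy gtn_eqF.
have /count_memPn -> : y \notin p.
  by apply/negP => /(allP ap); rewrite /= leqNgt -cy lca.
by rewrite !add0n !addn0 -has_pred1 has_count; case: (count _ v).
Qed.

(** * Anticommuting matrices *)

HB.instance Definition _ (R : pzRingType) m1 m2 n1 n2 :=
  GRing.Linear.copy (@ursubmx R m1 m2 n1 n2)
    (@rsubmx R m1 n1 n2 \o @usubmx R m1 m2 (n1 + n2)).

Section Grassmann.
Variable K : fieldType.

(** Generators of an exterior algebra, together with an involution g that
    represents its parity automorphism: it is what allows the adjunction of one
    more generator. *)
Definition grassmann_system m (e : nat -> 'M[K]_m) (g : 'M[K]_m) : Prop :=
  [/\ forall i j, e i * e j = - (e j * e i), forall i, e i * e i = 0,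
      g * g = 1 & forall i, g * e i = - (e i * g)].

Definition unipotent_word (R : pzRingType) (e : nat -> R) (v : seq nat) : R :=
  \prod_(i <- v) (1 + e i).

(** The exterior algebra on one more generator e_l, as a module over the smaller
    one with basis 1, e_l: the upper right block is the coefficient of e_l, up to
    the parity g. *)
Definition adjoin m (e : nat -> 'M[K]_m) (g : 'M[K]_m) l i : 'M[K]_(m + m) :=
  if i == l then block_mx 0 g 0 0 else block_mx (e i) 0 0 (e i).

Definition adjoin_grading m (g : 'M[K]_m) : 'M[K]_(m + m) := block_mx g 0 0 (- g).

Lemma grassmann_system_adjoin m (e : nat -> 'M[K]_m) g l :
  grassmann_system e g -> grassmann_system (adjoin e g l) (adjoin_grading g).
Proof.
case=> anti sq gg ge.
split=> [i j|i||i]; rewrite /adjoin /adjoin_grading.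
- case: (i == l); case: (j == l); rewrite -!mulmxE !mulmx_block opp_block_mx;
    rewrite ?(mul0mx, mulmx0, addr0, add0r, oppr0, block_mx0) //; rewrite !mulmxE.
  + by rewrite ge.
  + by rewrite ge opprK.
  by rewrite anti.
- case: (i == l); rewrite -!mulmxE !mulmx_block;
    rewrite ?(mul0mx, mulmx0, addr0, add0r, oppr0, block_mx0) //.
  by rewrite !mulmxE sq block_mx0.
- rewrite -mulmxE mulmx_block ?(mul0mx, mulmx0, addr0, add0r, oppr0) !mulmxE.
  by rewrite mulrNN gg -scalar_mx_block.
case: (i == l); rewrite -!mulmxE !mulmx_block opp_block_mx;
  rewrite ?(mul0mx, mulmx0, addr0, add0r, oppr0, mulmxN, mulNmx, opprK) //.
by rewrite !mulmxE ge opprK.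
Qed.

Lemma unipotent_word_adjoin_notin m (e : nat -> 'M[K]_m) g l v : l \notin v ->
  unipotent_word (adjoin e g l) v =
  block_mx (unipotent_word e v) 0 0 (unipotent_word e v).
Proof.
rewrite /unipotent_word; elim: v => [|i v IHv].
  by rewrite !big_nil -scalar_mx_block.
rewrite inE negb_or eq_sym => /andP[il /IHv]; rewrite !big_cons => ->.
rewrite /adjoin (negPf il) [X in (X + _) * _](scalar_mx_block m m) add_block_mx.
rewrite -mulmxE mulmx_block.
by rewrite ?(mul0mx, mulmx0, addr0, add0r).
Qed.

Lemma unipotent_word_adjoin m (e : nat -> 'M[K]_m) g l v : e l = 0 ->
  exists c, unipotent_word (adjoin e g l) v =
            block_mx (unipotent_word e v) c 0 (unipotent_word e v).
Proof.
move=> el0; rewrite /unipotent_word; elim: v => [|i v [c IHv]].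
  by exists 0; rewrite !big_nil -scalar_mx_block.
rewrite !big_cons IHv /adjoin.
rewrite [X in (X + _) * _](scalar_mx_block m m).
case: eqP => [->|_]; rewrite add_block_mx -mulmxE mulmx_block;
  rewrite ?(mul0mx, mulmx0, addr0, add0r) ?el0 ?addr0; by eexists.
Qed.

Lemma unipotent_word_pow m (e : nat -> 'M[K]_m) y v :
  e y * e y = 0 -> {in v, forall i, i != y -> e i = 0} ->
  unipotent_word e v = 1 + e y *+ count_mem y v.
Proof.
move=> sq; rewrite /unipotent_word; elim: v => [|i v IHv] ev0.
  by rewrite big_nil addr0.
rewrite big_cons IHv => [|j jv]; last by apply: ev0; rewrite inE jv orbT.
rewrite /=; have [->|iy] := eqVneq i y; last first.
  by rewrite ev0 ?mem_head // addr0 mul1r.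
by rewrite mulrDl mul1r mulrDr mulr1 mulrnAr sq mul0rn addr0 mulrSr addrA addrAC.
Qed.

(** By induction along the descents of the word. If lam separates the word w that
    follows the first descent x y, generators e_x and then e_y are adjoined, and
    r is sent to lam applied to the coefficient of e_y e_x in
    (1 + e_y)^-c r, where c is the number of letters y. *)
Lemma normal_word_independent b w : 2%:R != 0 :> K -> normal_word b w ->
  exists m (e : nat -> 'M[K]_m) g (lam : {scalar 'M[K]_m}),
  [/\ grassmann_system e g, forall i, (i <= b)%N -> e i = 0,
      lam (unipotent_word e w) != 0
    & forall v, perm_eq v w -> (v <= w :> seqlexi nat)%O -> v != w ->
        lam (unipotent_word e v) = 0].
Proof.
move=> two; elim=> {b w} [b w srt|b p x y w srt px /andP[lby yx] xw _].
  exists 1%N, (fun=> 0), 1, (mxtrace : {scalar 'M[K]_1}); split=> //.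
  - by split=> *; rewrite ?(mul0r, mulr0, oppr0, mulr1).
  - rewrite /unipotent_word big1 => [|i _]; last by rewrite addr0.
    by change (\tr (1%:M : 'M[K]_1) != 0); rewrite mxtrace1 oner_eq0.
  by move=> v pvw lvw; rewrite (sorted_lexi_min srt pvw lvw) eqxx.
case=> m [e [g [lam [gr e0 lamw lamv]]]].
have yNx : x != y by rewrite gtn_eqF.
pose e1 := adjoin e g x; pose g1 := adjoin_grading g.
pose e2 := adjoin e1 g1 y; pose g2 := adjoin_grading g1.
have gr1 : grassmann_system e1 g1 by exact: grassmann_system_adjoin.
have gr2 : grassmann_system e2 g2 by exact: grassmann_system_adjoin.
have e2_0 i : (i <= x)%N -> i != x -> i != y -> e2 i = 0.
  move=> ix nix niy; rewrite /e2 /adjoin (negPf niy) /e1 /adjoin (negPf nix).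
  by rewrite e0 // !block_mx0.
have sq : e2 y * e2 y = 0 by case: gr2.
have antixy : e2 x * e2 y = - (e2 y * e2 x) by case: gr2.
pose c := count_mem y (p ++ x :: y :: w).
pose lam2 : {scalar 'M[K]_(m + m + (m + m))} :=
  lam \o @ursubmx K m m m m \o @ursubmx K (m + m) (m + m) (m + m) (m + m)
      \o @mulmx K _ _ (m + m + (m + m)) (1 - e2 y *+ c).
have lam2E r : lam2 r = lam (ursubmx (ursubmx ((1 - e2 y *+ c) * r))) by [].
have free_vanish v : y \notin v -> ursubmx (unipotent_word e2 v) = 0.
  by move=> yv; rewrite unipotent_word_adjoin_notin // block_mxKur.
have word_cat v1 v2 :
    unipotent_word e2 (v1 ++ v2) = unipotent_word e2 v1 * unipotent_word e2 v2.
  exact: big_cat.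
have small_word v : all (fun i => i < x)%N v ->
    unipotent_word e2 v = 1 + e2 y *+ count_mem y v.
  move=> xv; apply: unipotent_word_pow => // i /(allP xv) /= ix niy.
  by apply: e2_0 => //; [exact: ltnW | rewrite ltn_eqF].
have yNw v : perm_eq v w -> y \notin v.
  by move=> pv; rewrite (perm_mem pv); apply/negP => /(allP xw); rewrite leqNgt yx.
(* The product of (1 + e_y)^-1, 1 + e_x and 1 + e_y is 1 + e_x - 2 e_y e_x, and
   only its last term contains both generators. *)
have lam2_desc v : perm_eq v w ->
    lam2 (unipotent_word e2 (p ++ x :: y :: v)) = - (2%:R * lam (unipotent_word e v)).
  move=> pvw; have yv := yNw v pvw.
  rewrite lam2E; have -> : c = (count_mem y p).+1.
    rewrite /c count_cat /= eqxx (negPf yNx) add0n.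
    by rewrite (count_memPn (yNw w (perm_refl w))) addn0 addn1.
  rewrite word_cat small_word //.
  set R := unipotent_word e2 v.
  have -> : unipotent_word e2 (x :: y :: v) = (1 + e2 x) * ((1 + e2 y) * R).
    by rewrite /unipotent_word !big_cons.
  have YXY : e2 y * e2 x * e2 y = 0.
    by rewrite -mulrA antixy mulrN mulrA sq mul0r oppr0.
  have -> : (1 - e2 y *+ (count_mem y p).+1) *
      ((1 + e2 y *+ count_mem y p) * ((1 + e2 x) * ((1 + e2 y) * R))) =
      (1 + e2 x) * R - (e2 y * e2 x * R) *+ 2.
    rewrite !mulrA; have -> : (1 - e2 y *+ (count_mem y p).+1) *
        (1 + e2 y *+ count_mem y p) = 1 - e2 y.
      rewrite mulrBl mul1r mulrDr mulr1 mulrnAl mulrnAr sq !mul0rn addr0.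
      by rewrite mulrSr opprD addrA addrK.
    have -> : (1 - e2 y) * (1 + e2 x) * (1 + e2 y) = 1 + e2 x - (e2 y * e2 x) *+ 2.
      rewrite !(mulrDr, mulrDl) !(mulr1, mul1r) !mulNr sq YXY antixy oppr0 !addr0.
      rewrite mulr2n opprD -!addrA; congr (_ + _).
      by rewrite (addrCA (- (e2 y * e2 x)) (e2 y)) (addrCA (e2 x)) addKr.
    by rewrite mulrBl mulrnAl.
  have yv' : y \notin x :: v by rewrite inE negb_or eq_sym yNx.
  have freeX : ursubmx ((1 + e2 x) * R) = 0.
    by have := free_vanish _ yv'; rewrite /unipotent_word big_cons.
  rewrite linearB /= freeX sub0r; rewrite /R unipotent_word_adjoin_notin //.
  have -> : e2 x = block_mx (e1 x) 0 0 (e1 x) by rewrite /e2 /adjoin (negPf yNx).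
  have -> : e2 y = block_mx 0 g1 0 0 by rewrite /e2 /adjoin eqxx.
  have -> : e1 x = block_mx 0 g 0 0 by rewrite /e1 /adjoin eqxx.
  (* After e_x, the further occurrences of 1 + e_x in v act as 1. *)
  have [d ->] := unipotent_word_adjoin g v (e0 x (leqnn x)).
  have gg : g *m g = 1%:M by case: gr.
  rewrite -!mulmxE !mulmx_block !(mul0mx, mulmx0, addr0, add0r) /g1.
  rewrite /adjoin_grading !mulmx_block !(mul0mx, mulmx0, addr0, add0r) gg mul1mx.
  rewrite !raddfN !raddfMn /= !block_mxKur.
  by rewrite mulr_natl mulNrn.
exists (m + m + (m + m))%N, e2, g2, lam2; split=> //.
- move=> i ib; apply: e2_0.
  + by rewrite ltnW // (leq_ltn_trans ib) // (ltn_trans lby).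
  + by rewrite ltn_eqF // (leq_ltn_trans ib) // (ltn_trans lby).
  by rewrite ltn_eqF // (leq_ltn_trans ib).
- by rewrite lam2_desc // oppr_eq0 mulf_neq0.
move=> v pv lv nv.
case: (lexi_descent_dichotomy srt px yx xw pv lv) => [[v1 [v2 [ev xv1 yv2]]]|].
  rewrite lam2E ev word_cat small_word //.
  have -> : count_mem y v1 = c.
    by rewrite /c -(permP pv) ev count_cat (count_memPn yv2) addn0.
  rewrite mulrA mulrBl mul1r mulrDr mulr1 mulrnAl mulrnAr sq !mul0rn addr0 addrK mul1r.
  by rewrite free_vanish // linear0 linear0.
case=> v' [ev pv' lv']; rewrite ev lam2_desc // lamv // ?mulr0 ?oppr0 //.
by apply: contraNneq nv => <-; rewrite ev.
Qed.

End Grassmann.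

(** * Supercommutative algebras satisfy [f, g, h] = 0 *)

Section Supercommutative.
Variables (R : pzRingType) (I : Type) (E : I -> R).
Hypothesis anti : forall i j, E i * E j = - (E j * E i).

Definition commutes_with_gens r := forall i, r * E i = E i * r.
Definition anticommutes_with_gens r := forall i, r * E i = - (E i * r).

(** The parities are defined without a grading of R: an even (odd) element has the
    commutation rules of a product of an even (odd) number of generators, with the
    generators and also with everything that commutes or anticommutes with them
    all. This second half is what makes two odd elements anticommute, and it is
    stable under products. *)
Definition even_elt z :=
  [/\ commutes_with_gens z,
      forall r, commutes_with_gens r -> z * r = r * z
    & forall r, anticommutes_with_gens r -> z * r = r * z].

Definition odd_elt o :=
  [/\ anticommutes_with_gens o,
      forall r, commutes_with_gens r -> o * r = r * o
    & forall r, anticommutes_with_gens r -> o * r = - (r * o)].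

Definition super_elt r := exists z o, [/\ even_elt z, odd_elt o & r = z + o].

Lemma odd_gen i : odd_elt (E i).
Proof.
split=> [j|r rE|r rE]; first exact: anti; first by rewrite rE.
by rewrite rE opprK.
Qed.

Lemma even_central z : (forall r, z * r = r * z) -> even_elt z.
Proof. by move=> zc; split=> [i|r _|r _]; rewrite zc. Qed.

Lemma evenD z z' : even_elt z -> even_elt z' -> even_elt (z + z').
Proof.
move=> [z1 z2 z3] [w1 w2 w3]; split=> [i|r rE|r rE]; rewrite mulrDl mulrDr.
- by rewrite z1 w1.
- by rewrite z2 // w2.
by rewrite z3 // w3.
Qed.

Lemma oddD o o' : odd_elt o -> odd_elt o' -> odd_elt (o + o').
Proof.
move=> [z1 z2 z3] [w1 w2 w3]; split=> [i|r rE|r rE]; rewrite mulrDl mulrDr ?opprD.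
- by rewrite z1 w1.
- by rewrite z2 // w2.
by rewrite z3 // w3.
Qed.

Lemma even0 : even_elt 0.
Proof. by split=> [i|r _|r _]; rewrite mulr0 mul0r. Qed.

Lemma odd0 : odd_elt 0.
Proof. by split=> [i|r _|r _]; rewrite mulr0 mul0r ?oppr0. Qed.

Lemma evenM z z' : even_elt z -> even_elt z' -> even_elt (z * z').
Proof.
move=> [z1 z2 z3] [w1 w2 w3]; split=> [i|r rE|r rE].
- by rewrite -mulrA w1 mulrA z1 mulrA.
- by rewrite -mulrA w2 // mulrA z2 // mulrA.
by rewrite -mulrA w3 // mulrA z3 // mulrA.
Qed.

Lemma even_oddM z o : even_elt z -> odd_elt o -> odd_elt (z * o).
Proof.
move=> [z1 z2 z3] [w1 w2 w3]; split=> [i|r rE|r rE].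
- by rewrite -mulrA w1 mulrN mulrA z1 mulrA.
- by rewrite -mulrA w2 // mulrA z2 // mulrA.
by rewrite -mulrA w3 // mulrN mulrA z3 // mulrA.
Qed.

Lemma odd_evenM z o : even_elt z -> odd_elt o -> odd_elt (o * z).
Proof.
move=> ze oo; have [z1 _ z3] := ze; have [o1 _ _] := oo.
by rewrite -z3 //; exact: even_oddM.
Qed.

Lemma oddM o o' : odd_elt o -> odd_elt o' -> even_elt (o * o').
Proof.
move=> [z1 z2 z3] [w1 w2 w3]; split=> [i|r rE|r rE].
- by rewrite -mulrA w1 mulrN mulrA z1 mulNr opprK mulrA.
- by rewrite -mulrA w2 // mulrA z2 // mulrA.
by rewrite -mulrA w3 // mulrN mulrA z3 // mulNr opprK mulrA.
Qed.

Lemma superD r s : super_elt r -> super_elt s -> super_elt (r + s).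
Proof.
move=> [z [o [ze oo ->]]] [z' [o' [ze' oo' ->]]].
by exists (z + z'), (o + o'); rewrite addrACA; split; [exact: evenD | exact: oddD |].
Qed.

Lemma super0 : super_elt 0.
Proof. by exists 0, 0; rewrite addr0; split; [exact: even0 | exact: odd0 |]. Qed.

Lemma super_even z : even_elt z -> super_elt z.
Proof. by move=> ze; exists z, 0; rewrite addr0; split=> //; exact: odd0. Qed.

Lemma super_odd o : odd_elt o -> super_elt o.
Proof. by move=> oo; exists 0, o; rewrite add0r; split=> //; exact: even0. Qed.

Lemma superM r s : super_elt r -> super_elt s -> super_elt (r * s).
Proof.
move=> [z [o [ze oo ->]]] [z' [o' [ze' oo' ->]]].
rewrite mulrDl !mulrDr; apply: superD; apply: superD.
- by apply: super_even; exact: evenM.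
- by apply: super_odd; exact: even_oddM.
- by apply: super_odd; exact: odd_evenM.
by apply: super_even; exact: oddM.
Qed.

Lemma even_comm_super z r : even_elt z -> super_elt r -> z * r = r * z.
Proof.
move=> [_ z2 z3] [z' [o' [[z'1 _ _] [o'1 _ _] ->]]].
by rewrite mulrDl mulrDr z2 // z3.
Qed.

(** Even parts commute with everything, so only twice the product of the odd
    parts remains. *)
Lemma super_commutator r s : super_elt r -> super_elt s -> even_elt (r * s - s * r).
Proof.
move=> [z [o [ze oo ->]]] ss; have := ss; move=> [z' [o' [ze' oo' es]]].
have -> : (z + o) * s - s * (z + o) = o * o' + o * o'.
  rewrite mulrDl mulrDr (even_comm_super ze ss) opprD addrACA subrr add0r.
  rewrite es mulrDl mulrDr.
  rewrite (even_comm_super ze' (super_odd oo)).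
  have [_ _ ->] := oo'; last by case: oo.
  by rewrite opprD addrACA subrr add0r opprK.
by apply: evenD; exact: oddM.
Qed.

Lemma super_commutator3 r s t : super_elt r -> super_elt s -> super_elt t ->
  (r * s - s * r) * t - t * (r * s - s * r) = 0.
Proof.
by move=> hr hs ht; rewrite (even_comm_super (super_commutator hr hs) ht) subrr.
Qed.

End Supercommutative.

(** * The Grassmann image of the free algebra *)

Section Terms.
Variables (M : monomType) (R : nzRingType).

Definition term (a : R) (k : M) : {malg R[M]} := << a *g k >>.

Lemma termM a b k l : term a k * term b l = term (a * b) (mmul k l).
Proof. exact: fgmulUU. Qed.

Lemma termD a b k : term (a + b) k = term a k + term b k.
Proof. exact: monalgUD. Qed.

Lemma termN a k : term (- a) k = - term a k.
Proof. exact: monalgUN. Qed.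

Lemma term_sum (r : {malg R[M]}) : r = \sum_(k <- msupp r) term r@_k k.
Proof. exact: monalgE. Qed.

Lemma mcoeff_term a k l : (term a k)@_l = a *+ (k == l).
Proof. exact: mcoeffU. Qed.
End Terms.

Lemma term_central (M : monomType) (R : nzRingType) (a : R) (k : M) :
  (forall b, a * b = b * a) -> (forall l, mmul k l = mmul l k) ->
  forall r, term a k * r = r * term a k.
Proof.
move=> ca ck r; rewrite [r]term_sum mulr_sumr mulr_suml; apply: eq_bigr => l _.
by apply: etrans (termM _ _ _ _) (esym (etrans (termM _ _ _ _) _)); rewrite ca ck.
Qed.

Lemma term_anticomm (M : conomType) (R : nzRingType) (a b : R) (k l : M) :
  a * b = - (b * a) -> term a k * term b l = - (term b l * term a k).
Proof.
move=> ab; apply: etrans (termM _ _ _ _) _; rewrite ab termN mulmC.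
by congr (- _); apply: esym (termM _ _ _ _).
Qed.

Definition indices N (w : seq (alphabet N)) : seq nat := map (@index_of N) w.

Section Representation.
Variables (K : fieldType) (N : option nat) (R : nzRingType)
  (scal : {rmorphism K -> R}) (e : nat -> R).
Hypothesis scal_central : forall c r, scal c * r = r * scal c.
Hypothesis anti : forall i j, e i * e j = - (e j * e i).
Local Notation A := (free_algebra K N).
Local Notation B := {malg R[{cmonom alphabet N}]}.

Definition content (w : seq (alphabet N)) : {cmonom alphabet N} :=
  \big[mmul/mone]_(i <- w) ucm i.

Lemma content_perm u v : content u = content v -> perm_eq u v.
Proof.
have cE w i : content w i = count_mem i w.
  rewrite /content; elim: w => [|j w IHw]; first by rewrite big_nil cm1.
  by rewrite big_cons cmM cmU IHw.
by move=> euv; apply/allP => i _ /=; rewrite -!cE euv.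
Qed.

(** The letter x_i goes to t_i (1 + e_i); the content of a word is its image in the
    polynomial ring in the commuting variables t_i. *)
Definition word_image (w : word N) : B :=
  term (unipotent_word e (indices w)) (content w).

Lemma word_image_mmorphism : mmorphism word_image.
Proof.
split=> [u v|]; rewrite /word_image ?fmM ?fm1.
  rewrite termM /indices /content map_cat big_cat.
  by rewrite /unipotent_word big_cat.
by rewrite /indices /content /unipotent_word !big_nil.
Qed.

HB.instance Definition _ :=
  isMultiplicative.Build (word N) B word_image word_image_mmorphism.

Definition scalar_image : K -> B := @malgC {cmonom alphabet N} R \o scal.
HB.instance Definition _ := GRing.RMorphism.on scalar_image.

Definition grassmann_image : A -> B := mmap scalar_image word_image.
HB.instance Definition _ := GRing.Additive.on grassmann_image.

Lemma scalar_image_central c r : scalar_image c * r = r * scalar_image c.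
Proof. by apply: (term_central (scal_central c)) => l; rewrite mul1m mulm1. Qed.

Lemma grassmann_imageM : {morph grassmann_image : f g / f * g}.
Proof.
have central (g : A) u v : GRing.comm (scalar_image g@_u) (word_image v).
  exact: scalar_image_central.
by have [] := @commr_mmap_is_multiplicative _ _ _ scalar_image word_image central.
Qed.

Definition odd_letter (i : alphabet N) : B := term (e i) (ucm i).

Lemma odd_letter_anti i j :
  odd_letter i * odd_letter j = - (odd_letter j * odd_letter i).
Proof. exact: term_anticomm. Qed.

Lemma grassmann_image_super f : super_elt odd_letter (grassmann_image f).
Proof.
rewrite /grassmann_image mmapE; apply: big_ind => [||w _].
- exact: super0.
- by move=> r s; exact: superD.
apply: superM; first by apply/super_even/even_central/scalar_image_central.
rewrite /word_image; elim: (fmonom_val w) => [|i v IHv].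
  rewrite /indices /content /unipotent_word !big_nil.
  by apply/super_even/even_central => r; rewrite mul1r mulr1.
rewrite /indices /content /unipotent_word /= !big_cons.
rewrite -termM; apply: superM IHv.
rewrite termD; apply: superD; last by apply/super_odd/odd_gen/odd_letter_anti.
apply/super_even/even_central/term_central => [r|l]; last exact: mulmC.
by rewrite mul1r mulr1.
Qed.

Lemma grassmann_image_commutator f g :
  grassmann_image (commutator f g) =
  grassmann_image f * grassmann_image g - grassmann_image g * grassmann_image f.
Proof.
by apply: etrans (raddfB _ _ _) _; congr (_ - _); exact: grassmann_imageM.
Qed.

Lemma grassmann_image_T_ideal f : @T_ideal_comm3 K N f -> grassmann_image f = 0.
Proof.
move=> If; apply: (If [set g | grassmann_image g = 0]); split.
  split=> /= [|g h g0 h0|g h k h0]; first exact: raddf0.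
    by rewrite raddfD /= g0 h0 addr0.
  by rewrite !grassmann_imageM h0 mulr0 mul0r.
move=> _ [f1 [f2 [f3 ->]]]; rewrite /mkset 2!grassmann_image_commutator.
by apply: (@super_commutator3 B _ odd_letter); exact: grassmann_image_super.
Qed.

(** Comparing the coefficients of one monomial in the t_i. *)
Lemma T_ideal_word_relation f (lam : {additive R -> K}) u :
  (forall c r, lam (scal c * r) = c * lam r) ->
  @T_ideal_comm3 K N f ->
  \sum_(w <- msupp f | content w == content u)
     f@_w * lam (unipotent_word e (indices w)) = 0.
Proof.
move=> lamZ /grassmann_image_T_ideal /(congr1 (mcoeff (content u))) /(congr1 lam).
rewrite mcoeff0 raddf0; apply: etrans.
rewrite /grassmann_image mmapE !raddf_sum /= [LHS]big_mkcond.
apply: eq_bigr => w _.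
rewrite /scalar_image /= mul_malgC mcoeffZ /word_image mcoeff_term.
case: eqP => _; last by rewrite mulr0 raddf0.
by rewrite mulr1n lamZ.
Qed.

End Representation.

(** In the relation between the words of f that are rearrangements of its leading
    monomial, the linear form attached to a normal leading monomial would leave a
    single nonzero term. *)
Lemma T_ideal_lmonom_not_normal (K : fieldType) N (f : free_algebra K N) :
  2%:R != 0 :> K -> @T_ideal_comm3 K N f -> f != 0 ->
  ~ normal_word 0 (indices (lmonom f)).
Proof.
move=> two If f0 nw.
have [m [e [g [lam [gr _ lamw lamv]]]]] := normal_word_independent two nw.
case: m => [|m] in e g lam gr lamw lamv.
  by move: lamw; rewrite (flatmx0 (unipotent_word _ _)) linear0 eqxx.
have anti : forall i j, e i * e j = - (e j * e i) by case: gr.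
have [lf fle] := lmonomP f0.
have scalar_comm c (r : 'M[K]_m.+1) : scalar_mx c * r = r * scalar_mx c.
  exact: comm_scalar_mx.
have lamZ c (r : 'M[K]_m.+1) : lam (scalar_mx c * r) = c * lam r.
  by rewrite [_ * r]mul_scalar_mx linearZ.
have := T_ideal_word_relation scalar_comm anti (lmonom f) lamZ If.
rewrite big_mkcond (big_fsetD1 (lmonom f)) //= eqxx big1_seq => [|w].
  rewrite addr0 => /eqP; rewrite mulf_eq0 (negPf lamw) orbF.
  by rewrite mcoeff_eq0 lf.
rewrite in_fsetD1 => /andP[_ /andP[nw' wf]]; case: eqP => // cw.
have pw := content_perm cw.
rewrite lamv ?mulr0 //.
- exact: perm_map.
- move: (fle w wf); rewrite /deglex (perm_size pw) ltnn eqxx /=; exact.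
apply: contraNneq nw' => /(inj_map val_inj) eqw.
by apply/eqP; apply: val_inj.
Qed.

(** * Words with a forbidden factor *)

Section Obstructions.
Variable N : option nat.
Implicit Types (u v w p q : seq (alphabet N)) (a b c x y z t : alphabet N).

(** The leading monomials of [[a, c], a], of [[a, b], c] and of
    [y, x] q [t, z] + [y, t] q [x, z]. *)
Inductive obstruction : seq (alphabet N) -> Prop :=
| ObstructionDouble a c : (c < a)%N -> obstruction [:: a; a; c]
| ObstructionTop a b c : (b < a)%N -> (c < a)%N -> obstruction [:: a; b; c]
| ObstructionPair x y q z t :
    (y < x)%N -> (t < z)%N -> (t <= x)%N -> sorted leq (indices q) ->
    obstruction (x :: y :: q ++ [:: z; t]).

Lemma first_descent w : sorted leq (indices w) \/
  exists p x y s, [/\ w = p ++ x :: y :: s, sorted leq (indices (rcons p x))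
                    & (y < x)%N].
Proof.
elim: w => [|a [|c w] IHw]; [by left | by left |].
have [lac|lca] := leqP a c; last by right; exists [::], a, c, w.
case: IHw => [srt|[p [x [y [s [e srt yx]]]]]]; first by left; rewrite /= lac.
right; exists (a :: p), x, y, s; split=> //; first by rewrite e.
by case: p e srt => [|d p] [<- _]; rewrite /= lac.
Qed.

Lemma normal_word_ge (b : nat) x w :
  normal_word b (indices (x :: w)) -> (b <= x)%N -> all (leq b) (indices (x :: w)).
Proof.
move E: (indices _) => s nw.
case: nw E => {b s} [b s srt|b p c y s srt pc /andP[lby yc] cs _] E bx.
  move: srt; rewrite -E /= (path_sortedE leq_trans) => /andP[xw _].
  by rewrite bx; apply: sub_all xw => i; apply: leq_trans.
have bc : (b <= c)%N := ltnW (ltn_trans lby yc).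
rewrite all_cat /= bc (ltnW lby) /=; apply/andP; split; last first.
  by apply: sub_all cs => i; apply: leq_trans.
case: p E srt pc => [//|d p] [<- _] /=; rewrite (path_sortedE leq_trans).
by move=> /andP[xp _] _; rewrite bx; apply: sub_all xp => i; apply: leq_trans.
Qed.

(** The factors of length three force the letters around a descent x y to be as in a
    normal word; the last kind of factors compares x with the next descent z t.
    The third alternative reports a first descent that fails to lie above b. *)
Lemma normal_or_obstructed (b : nat) w :
  [\/ normal_word b (indices w),
      exists2 u, obstruction u & infix u w
    | exists p x y s, [/\ w = p ++ x :: y :: s, sorted leq (indices p),
                         (y < x)%N & (y <= b)%N]].
Proof.
have [n] := ubnP (size w); elim: n b w => // n IHn b w /ltnSE szw.
case: (first_descent w) => [srt|[p [x [y [s [ew srt yx]]]]]].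
  by constructor 1; apply: NormalSorted.
have srtp : sorted leq (indices p).
  by move: srt; rewrite /indices map_rcons -cats1 => /cat_sorted2[].
have [yb|lby] := leqP y b; first by constructor 3; exists p, x, y, s.
have px : (exists p' , p = rcons p' x) \/ all (fun i => i < x)%N (indices p).
  elim/last_ind: p {ew} srt srtp => [|p a _] srt srtp; first by right.
  have ax : (a <= x)%N.
    move: srt; rewrite /indices !map_rcons -!cats1 -catA.
    by move=> /cat_sorted2[_] /= /andP[].
  have [eax|nax] := eqVneq a x; first by left; exists p; rewrite eax.
  right; rewrite /indices map_rcons all_rcons; have lax : (a < x)%N.
    by rewrite ltn_neqAle ax andbT; apply: contraNneq nax => /val_inj ->.
  rewrite lax /=; move: srtp; rewrite /indices map_rcons.
  rewrite (sorted_pairwise leq_trans) pairwise_rcons.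
  move=> /andP[pa _]; apply: sub_all pa => i /= ia; exact: leq_ltn_trans ia lax.
case: px => [[p' ep]|px].
  constructor 2; exists [:: x; x; y]; first exact: ObstructionDouble.
  by rewrite ew ep cat_rcons; apply: infix_infix.
have szs : (size s < n)%N.
  by apply: leq_trans szw; rewrite ew size_cat /= !addnS ltnS leqW // leq_addl.
case: (IHn x s szs) => [nw|[u ou us]|[q [z [t [r [es srtq tz tx]]]]]].
- have [xs|[z [r [es zx]]]] :
    all (leq x) (indices s) \/ exists z r, s = z :: r /\ (z < x)%N.
    case: s nw {ew szs} => [|z r] nw; first by left.
    have [xz|zx] := leqP x z; last by right; exists z, r.
    by left; apply: normal_word_ge.
  + constructor 1; rewrite ew /indices map_cat /=.
    by apply: NormalDescent => //; rewrite lby.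
  constructor 2; exists [:: x; y; z]; first exact: ObstructionTop.
  by rewrite ew es; apply/infixP; exists p, r.
- constructor 2; exists u => //; apply: infix_trans us _.
  by rewrite ew; apply/infixP; exists (p ++ [:: x; y]), [::]; rewrite cats0 -catA.
constructor 2; exists (x :: y :: q ++ [:: z; t]); first exact: ObstructionPair.
by rewrite ew es; apply/infixP; exists p, r; rewrite /= -catA.
Qed.

Lemma normal_or_obstruction w :
  normal_word 0 (indices w) \/ exists2 u, obstruction u & infix u w.
Proof.
case: (normal_or_obstructed 0 w) => [|ou|[p [x [y [s [_ _ _]]]]]]; [by left|by right|].
by case: y => y /= /andP[y0 _]; rewrite leqNgt y0.
Qed.

End Obstructions.

(** * Elements of the T-ideal *)

(** Expanding [[a, b c], d] by the Leibniz rule yields, apart from triple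
    commutators, the sum [a, b] [c, d] + [b, d] [a, c]. *)
Lemma latyshev_identity (R : pzRingType) (a b c d : R) :
  let k f g := f * g - g * f in
  k (k a (b * c)) d = b * k (k a c) d + k (k a b) d * c
    + (k (k b d) (k a c) + (k a b * k c d + k a c * k b d)).
Proof.
move=> k.
have kMl f g h : k (f * g) h = f * k g h + k f h * g.
  by rewrite /k mulrBr mulrBl !mulrA addrA subrK.
have kMr f g h : k f (g * h) = g * k f h + k f g * h.
  by rewrite /k mulrBr mulrBl !mulrA [RHS]addrC addrA subrK.
have kDl f g h : k (f + g) h = k f h + k g h.
  by rewrite /k mulrDl mulrDr opprD addrACA.
have swap : k b d * k a c = k a c * k b d + k (k b d) (k a c).
  by rewrite [k (k b d) _]/k addrC subrK.
rewrite kMr kDl !kMl swap.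
set p := b * _; set q := _ * c; set r := k (k b d) _.
set s1 := k a c * _; set s2 := k a b * _.
rewrite [s2 + q]addrC addrACA; congr (_ + _).
by rewrite [s1 + r]addrC -addrA [s1 + s2]addrC.
Qed.

Lemma insert_identity (R : pzRingType) (f g h k e : R) :
  f * e * h + g * e * k =
  e * (f * h + g * k) + ((f * e - e * f) * h + (g * e - e * g) * k).
Proof.
rewrite mulrDr !mulrBl addrACA !mulrA.
by rewrite [_ + (_ - _)]addrC subrK [_ + (_ - _)]addrC subrK.
Qed.

Section TIdeal.
Variables (K : fieldType) (N : option nat).
Local Notation A := (free_algebra K N).
Local Notation T := (@T_ideal_comm3 K N).
Implicit Types f g h : A.

Lemma T_ideal_two_sided : two_sided_ideal T.
Proof.
split=> [I [[I0 _ _] _] //|f g Tf Tg I IP|f g h Tg I IP].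
  have [[_ ID _] _] := IP.
  by apply: ID; [exact: Tf | exact: Tg].
by have [[_ _ IM] _] := IP; apply: IM; exact: Tg.
Qed.

Lemma T_idealD f g : T f -> T g -> T (f + g).
Proof. by have [_ TD _] := T_ideal_two_sided; exact: TD. Qed.

Lemma T_idealM f g h : T g -> T (f * g * h).
Proof. by have [_ _ TM] := T_ideal_two_sided; exact: TM. Qed.

Lemma T_idealMl f g : T g -> T (f * g).
Proof. by move=> /(T_idealM f 1); rewrite mulr1. Qed.

Lemma T_idealMr g h : T g -> T (g * h).
Proof. by move=> /(T_idealM 1 h); rewrite mul1r. Qed.

Lemma T_idealN f : T f -> T (- f).
Proof. by move=> /(T_idealMl (- 1)); rewrite mulN1r. Qed.

Lemma T_idealDr f g : T f -> T (f + g) -> T g.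
Proof. by move=> /T_idealN Tf /(T_idealD Tf); rewrite addKr. Qed.

Lemma T_ideal_commutator3 f g h : T (commutator (commutator f g) h).
Proof. by move=> I [_]; apply; exists f, g, h. Qed.

Lemma endo_commutator (phi : endo K N) f g :
  phi (commutator f g) = commutator (phi f) (phi g).
Proof.
by apply: etrans (rmorphB _ _ _) _; congr (_ - _); exact: rmorphM.
Qed.

Lemma T_ideal_endo (phi : endo K N) f : T f -> T (phi f).
Proof.
move=> Tf; apply: (Tf [set g | T (phi g)]); split.
  split=> /= [|g h Tg Th|g h k Th].
  - by rewrite raddf0; have [] := T_ideal_two_sided.
  - by rewrite raddfD; exact: T_idealD.
  by rewrite !rmorphM; exact: T_idealM.
move=> _ [f1 [f2 [f3 ->]]]; rewrite /mkset 2!endo_commutator.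
exact: T_ideal_commutator3.
Qed.

Lemma T_ideal_commutatorM a b c d :
  T (commutator a b * commutator c d + commutator a c * commutator b d).
Proof.
have E := latyshev_identity a b c d.
have : T (commutator (commutator a (b * c)) d) by exact: T_ideal_commutator3.
rewrite [commutator (commutator a (b * c)) d]E => TE.
apply: (T_idealDr (T_ideal_commutator3 b d (commutator a c))).
apply: T_idealDr TE; apply: T_idealD.
  exact: (T_idealMl b (T_ideal_commutator3 a c d)).
exact: (T_idealMr c (T_ideal_commutator3 a b d)).
Qed.

Lemma T_ideal_latyshev a b c d e :
  T (commutator a b * e * commutator c d + commutator a c * e * commutator b d).
Proof.
have E := insert_identity (commutator a b) (commutator a c)
  (commutator c d) (commutator b d) e.
rewrite E; apply: T_idealD; first exact: (T_idealMl e (T_ideal_commutatorM a b c d)).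
apply: T_idealD; first exact: (T_idealMr _ (T_ideal_commutator3 a b e)).
exact: (T_idealMr _ (T_ideal_commutator3 a c e)).
Qed.

End TIdeal.

(** * Endomorphisms *)

Section Substitution.
Variables (K : fieldType) (N : option nat).
Local Notation A := (free_algebra K N).
Variable s : alphabet N -> A.

Definition word_subst (w : word N) : A := \prod_(i <- fmonom_val w) s i.

Lemma word_subst_mmorphism : mmorphism word_subst.
Proof.
by split=> [u v|]; rewrite /word_subst ?fmM ?fm1 ?big_cat ?big_nil.
Qed.

HB.instance Definition _ :=
  isMultiplicative.Build (word N) A word_subst word_subst_mmorphism.

Definition subst : A -> A := mmap (@malgC (word N) K) word_subst.

HB.instance Definition _ := GRing.Additive.on subst.

Lemma subst_multiplicative : multiplicative subst.
Proof.
have central (g : A) u v : GRing.comm (malgC g@_u) (word_subst v).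
  by apply: (@term_central (word N) K) => [c|l]; [exact: mulrC | rewrite mul1m mulm1].
exact: (@commr_mmap_is_multiplicative _ _ _ (@malgC (word N) K) word_subst central).
Qed.

HB.instance Definition _ := GRing.isMultiplicative.Build A A subst subst_multiplicative.

Lemma subst_scalable : scalable subst.
Proof. by move=> c g; rewrite /subst mmapZ mul_malgC. Qed.

HB.instance Definition _ := GRing.isScalable.Build K A A *:%R subst subst_scalable.

Lemma subst_letter i : subst (letter K i) = s i.
Proof.
rewrite /subst /letter mmapU mul_malgC scale1r /word_subst fmU.
by rewrite big_cons big_nil mulr1.
Qed.

End Substitution.

Lemma exists_endo (K : fieldType) N (s : alphabet N -> free_algebra K N) :
  exists phi : endo K N, forall i, phi (letter K i) = s i.
Proof. by exists (subst s) => i; exact: subst_letter. Qed.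

Lemma in_alphabet_le N i m :
  (0 < i)%N -> (i <= m)%N -> in_alphabet N m -> in_alphabet N i.
Proof.
rewrite /in_alphabet => -> im /andP[_]; case: N => // n; exact: leq_trans.
Qed.

Lemma prod_powers_cons (R : pzRingType) (X : nat -> R) b m j s :
  (b <= j)%N -> (j <= m)%N -> all (leq j) s ->
  \prod_(b <= i < m.+1) X i ^+ count_mem i (j :: s) =
  X j * \prod_(j <= i < m.+1) X i ^+ count_mem i s.
Proof.
move=> bj jm js; rewrite (big_cat_nat bj (leqW jm)) /=.
rewrite [X in X * _]big_nat_cond big1 => [|i /andP[/andP[_ ij] _]]; last first.
  rewrite gtn_eqF // add0n (count_memPn _) ?expr0 //.
  by apply/negP => /(allP js); rewrite /= leqNgt ij.
rewrite mul1r big_ltn ?ltnS // [X in _ = _ * X]big_ltn ?ltnS // eqxx add1n exprS mulrA.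
congr (_ * _).
by apply: eq_big_nat => i /andP[ji _]; rewrite ltn_eqF.
Qed.

Section Words.
Variables (K : fieldType) (N : option nat).
Local Notation A := (free_algebra K N).
Implicit Types (u v w p q : seq (alphabet N)) (a b c x y z t : alphabet N).

Definition mword w : A := << FMonom w >>.

Lemma mwordM u v : mword u * mword v = mword (u ++ v).
Proof.
apply: etrans (fgmulUU _ _ _ _) _; rewrite mulr1 /mword; congr (<< _ >>).
by apply: val_inj; rewrite /= fmM.
Qed.

Lemma mword_nil : mword [::] = 1.
Proof. by rewrite /mword; congr (<< _ >>); apply: val_inj; rewrite /= fm1. Qed.

Lemma letterE i : letter K i = mword [:: i].
Proof.
by rewrite /letter /mword; congr (<< _ >>); apply: val_inj; rewrite /= fmU.
Qed.

Lemma mcoeff_mword u v : (mword u)@_(FMonom v) = (u == v)%:R.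
Proof. by rewrite mcoeffU1 fmP. Qed.

Lemma var_letter (i : alphabet N) : var K N i = letter K i.
Proof. by rewrite /var valK. Qed.

Lemma sorted_word_power_product (m b : nat) q : sorted leq (indices q) ->
  all (fun i => b <= i <= m)%N (indices q) ->
  mword q = \prod_(b <= i < m.+1) var K N i ^+ count_mem i (indices q).
Proof.
elim: q b => [|j q IHq] b srt bq.
  by rewrite mword_nil big1 // => i _; rewrite expr0.
have /andP[jq srtq] : all (leq j) (indices q) && sorted leq (indices q).
  by move: srt; rewrite /= (path_sortedE leq_trans).
move: bq => /= /andP[/andP[bj jm] bq].
have jqm : all (fun i => j <= i <= m)%N (indices q).
  apply/allP => i iq; rewrite (allP jq) //=.
  by have /andP[] := allP bq i iq.
apply: etrans (esym (prod_powers_cons _ bj jm jq)).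
by rewrite -cat1s -mwordM (IHq j srtq jqm) -letterE -var_letter.
Qed.

(** The length m is the greatest letter of q, so the variables that occur are all
    in the alphabet. *)
Lemma sorted_word_product q : sorted leq (indices q) ->
  exists (m : nat) (a : nat -> nat),
     (forall i, (1 <= i <= m)%N -> in_alphabet N i) /\
     mword q = \prod_(1 <= i < m.+1) var K N i ^+ a i.
Proof.
move=> srt; pose m := \max_(i <- indices q) i.
have qm i : i \in indices q -> (i <= m)%N by move=> iq; apply: leq_bigmax_seq.
exists m, (fun i => count_mem i (indices q)); split=> [i /andP[i0 im]|]; last first.
  apply: sorted_word_power_product => //; apply/allP => i iq; rewrite qm // andbT.
  by case/mapP: iq => -[j /= /andP[]] /= j0 _ _ ->.
have [q0|] := eqVneq (indices q) [::].
  by move: im; rewrite /m q0 big_nil leqNgt i0.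
rewrite -size_eq0 -lt0n => szq.
have /mapP[[j jN] _ ej] : m \in indices q.
  rewrite /m; elim: (indices q) szq => // k s IHs _; rewrite big_cons.
  have [->|s0] := eqVneq s [::]; first by rewrite big_nil maxn0 mem_head.
  rewrite /maxn; case: ifP => _; last by rewrite mem_head.
  by rewrite inE IHs ?orbT // lt0n size_eq0.
by apply: (in_alphabet_le i0 im); rewrite ej.
Qed.

End Words.

Lemma rmorph_latyshev (R R' : pzRingType) (phi : {rmorphism R -> R'}) f g h k e :
  phi ((f * g - g * f) * e * (h * k - k * h) + (f * h - h * f) * e * (g * k - k * g)) =
  (phi f * phi g - phi g * phi f) * phi e * (phi h * phi k - phi k * phi h) +
  (phi f * phi h - phi h * phi f) * phi e * (phi g * phi k - phi k * phi g).
Proof. by rewrite !(rmorphD, rmorphN, rmorphM). Qed.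

Section SImages.
Variables (K : fieldType) (N : option nat).
Hypothesis hN : if N is Some n then (5 <= n)%N else true.
Local Notation A := (free_algebra K N).
Local Notation x := (var K N).
Local Notation L a := (mword K [:: a]).
Implicit Types (u v w p q : seq (alphabet N)) (a b c d : alphabet N).

Lemma in_alphabet5 i : (1 <= i <= 5)%N -> in_alphabet N i.
Proof. by move=> /andP[i1 i5]; apply: (in_alphabet_le i1 i5). Qed.

Lemma S_generator_endo (phi : endo K N) : S_generator phi -> S_endo phi.
Proof. by move=> Sphi S [_]; apply. Qed.

Lemma S_endo_subsemigroup : subsemigroup (@S_endo K N).
Proof.
move=> phi psi Sphi Spsi S SP; have [SM _] := SP.
by apply: SM; [exact: Sphi | exact: Spsi].
Qed.

Lemma var_in_alphabet i : in_alphabet N i ->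
  exists2 j : alphabet N, index_of j = i & x i = letter K j.
Proof.
by move=> iN; exists (Alphabet iN) => //; rewrite -var_letter.
Qed.

Lemma S_endo_id : S_endo (idfun : endo K N).
Proof.
apply: S_generator_endo; split.
  move=> i /andP[i1 i4]; have /var_in_alphabet[j _ xj] : in_alphabet N i.
    by apply: in_alphabet5; rewrite i1 leqW.
  by exists j.
have /var_in_alphabet[j ej xj] : in_alphabet N 5 by exact: in_alphabet5.
have [m [a [mN E]]] := @sorted_word_product K N [:: j] isT.
by exists m, a; split=> //; rewrite -E /= xj letterE.
Qed.

Lemma exists_S_endo a b c d q : sorted leq (indices q) ->
  exists phi : endo K N, S_endo phi /\
    [/\ phi (x 1) = L a, phi (x 2) = L b, phi (x 3) = L c,
        phi (x 4) = L d & phi (x 5) = mword K q].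
Proof.
move=> srt; pose s (l : alphabet N) := nth (letter K l)
  [:: 0; L a; L b; L c; L d; mword K q] l.
have [phi phiE] := exists_endo s.
have phix i : (1 <= i <= 5)%N -> phi (x i) = nth 0
    [:: 0; L a; L b; L c; L d; mword K q] i.
  move=> i15; have [j ej ->] := var_in_alphabet (in_alphabet5 i15).
  rewrite phiE /s ej; apply: set_nth_default.
  by case/andP: i15.
exists phi; split; last by rewrite !phix.
apply: S_generator_endo; split.
  case=> [|[|[|[|[|i]]]]] // _; rewrite phix //=.
  - by exists a; rewrite letterE.
  - by exists b; rewrite letterE.
  - by exists c; rewrite letterE.
  by exists d; rewrite letterE.
have [m [e [mN E]]] := @sorted_word_product K N q srt.
by exists m, e; split=> //; rewrite -E phix.
Qed.

Definition triple_commutator (f g h : A) : A := commutator (commutator f g) h.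

Definition latyshev_poly (f g h k e : A) : A :=
  commutator f g * e * commutator h k + commutator f h * e * commutator g k.

Lemma endo_latyshev_poly (phi : endo K N) f g h k e :
  phi (latyshev_poly f g h k e) =
  latyshev_poly (phi f) (phi g) (phi h) (phi k) (phi e).
Proof.
exact: rmorph_latyshev.
Qed.

Definition S_basis : set A :=
  [set triple_commutator (x 1) (x 2) (x 3);
       latyshev_poly (x 1) (x 2) (x 3) (x 4) (x 5)].

Lemma S_image_triple a b c :
  S_image (@S_endo K N) S_basis
    (triple_commutator (L a) (L b) (L c)).
Proof.
have [phi [Sphi [p1 p2 p3 _ _]]] := exists_S_endo a b c a (q := [::]) isT.
exists phi => //; exists (triple_commutator (x 1) (x 2) (x 3)); first by left.
by rewrite /triple_commutator 2!endo_commutator p1 p2 p3.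
Qed.

Lemma S_image_latyshev a b c d q : sorted leq (indices q) ->
  S_image (@S_endo K N) S_basis
    (latyshev_poly (L a) (L b) (L c) (L d) (mword K q)).
Proof.
move=> srt; have [phi [Sphi [p1 p2 p3 p4 p5]]] := exists_S_endo a b c d srt.
exists phi => //; exists (latyshev_poly (x 1) (x 2) (x 3) (x 4) (x 5)); first by right.
have congr5 f f' g g' h h' k k' e e' : f = f' -> g = g' -> h = h' -> k = k' ->
    e = e' -> latyshev_poly f g h k e = latyshev_poly f' g' h' k' e'.
  by move=> -> -> -> -> ->.
apply: etrans (endo_latyshev_poly _ _ _ _ _ _) _.
exact: congr5 p1 p2 p3 p4 p5.
Qed.

End SImages.

(** * Leading monomials *)

Section LeadingMonomials.
Variables (K : fieldType) (N : option nat).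
Local Notation A := (free_algebra K N).
Implicit Types (u v w p q : seq (alphabet N)) (a b c x y z t : alphabet N).
Implicit Types (f g : A).

Definition word_lt u v :=
  (size u == size v) && (indices u < indices v :> seqlexi nat)%O.

Lemma word_lt_head a b u v : (b < a)%N -> size u = size v -> word_lt (b :: u) (a :: v).
Proof.
move=> ba suv; rewrite /word_lt /= suv eqxx ltxi_cons !leEnat (ltnW ba) /=.
by rewrite leqNgt ba.
Qed.

Lemma word_lt_cons a u v : word_lt u v -> word_lt (a :: u) (a :: v).
Proof. by rewrite /word_lt /= eqSS ltxi_cons lexx. Qed.

Lemma word_lt_cat p u v : word_lt u v -> word_lt (p ++ u) (p ++ v).
Proof. by move=> uv; elim: p => //= a p; exact: word_lt_cons. Qed.

Definition below w f := forall v, f@_(FMonom v) != 0 -> word_lt v w.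

Lemma belowD w f g : below w f -> below w g -> below w (f + g).
Proof.
move=> fw gw v; rewrite mcoeffD; have [f0|/fw//] := eqVneq f@_(FMonom v) 0.
by rewrite f0 add0r; exact: gw.
Qed.

Lemma belowN w f : below w f -> below w (- f).
Proof. by move=> fw v; rewrite mcoeffN oppr_eq0; exact: fw. Qed.

Lemma below_mword w u : word_lt u w -> below w (mword K u).
Proof.
by move=> uw v; rewrite mcoeff_mword; case: (u =P v) => [<-//|_]; rewrite eqxx.
Qed.

Lemma lmonom_below (c : K) w f : c != 0 -> below w f ->
  c *: mword K w + f != 0 /\ lmonom (c *: mword K w + f) = FMonom w.
Proof.
move=> c0 fw; set g := _ + f.
have gw : g@_(FMonom w) = c.
  rewrite /g mcoeffD mcoeffZ mcoeff_mword eqxx mulr1.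
  have [->|/fw] := eqVneq f@_(FMonom w) 0; first by rewrite addr0.
  by rewrite /word_lt ltxx andbF.
have gle (v : word N) : v \in msupp g -> deglex v (FMonom w).
  rewrite -mcoeff_neq0 -[v]fmK /g mcoeffD mcoeffZ mcoeff_mword.
  have [<-|nwv] := eqVneq w v; first by rewrite deglex_refl.
  rewrite mulr0 add0r => /fw; rewrite /word_lt /deglex /= => /andP[-> lt].
  by rewrite (ltW lt) orbT.
have g0 : g != 0 by apply: contraNneq c0 => g0; rewrite -gw g0 mcoeff0.
split=> //; have [lg gmax] := lmonomP g0.
apply: deglex_anti; rewrite gle //; apply: gmax.
by rewrite -mcoeff_neq0 gw.
Qed.

End LeadingMonomials.

Section WordExpansions.
Variables (R : pzRingType) (T : Type) (W : seq T -> R).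
Hypothesis WM : forall u v, W u * W v = W (u ++ v).
Implicit Types (a b c x y z t : T) (q : seq T).

Lemma triple_commutator_expansion a b c :
  (W [:: a] * W [:: b] - W [:: b] * W [:: a]) * W [:: c]
  - W [:: c] * (W [:: a] * W [:: b] - W [:: b] * W [:: a]) =
  W [:: a; b; c] - W [:: b; a; c] - (W [:: c; a; b] - W [:: c; b; a]).
Proof. by rewrite mulrBl mulrBr !WM. Qed.

Lemma commutator_pair_expansion y x t z q :
  (W [:: y] * W [:: x] - W [:: x] * W [:: y]) * W q
    * (W [:: t] * W [:: z] - W [:: z] * W [:: t]) =
  W (x :: y :: q ++ [:: z; t])
  + (W (y :: x :: q ++ [:: t; z]) - W (y :: x :: q ++ [:: z; t])
     - W (x :: y :: q ++ [:: t; z])).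
Proof.
rewrite !mulrBr !mulrBl !WM /= opprB.
by rewrite addrCA [X in _ + X]addrAC.
Qed.

Lemma double_commutator_expansion a c :
  (W [:: a] * W [:: c] - W [:: c] * W [:: a]) * W [:: a]
  - W [:: a] * (W [:: a] * W [:: c] - W [:: c] * W [:: a]) =
  - W [:: a; a; c] + (W [:: a; c; a] - W [:: c; a; a] + W [:: a; c; a]).
Proof.
by rewrite triple_commutator_expansion opprB addrA [RHS]addrC.
Qed.

End WordExpansions.

Lemma opp_triple_commutator (R : pzRingType) (f g h : R) :
  - ((f * g - g * f) * h - h * (f * g - g * f)) =
  (g * f - f * g) * h - h * (g * f - f * g).
Proof. by rewrite -(opprB (g * f)) mulNr mulrN -opprD opprK. Qed.

Section ObstructionImages.
Variables (K : fieldType) (N : option nat).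
Local Notation L a := (mword K [:: a]).
Hypothesis two : 2%:R != 0 :> K.
Hypothesis hN : if N is Some n then (5 <= n)%N else true.
Implicit Types (u v w p q : seq (alphabet N)) (a b c x y z t : alphabet N).

Lemma lmonom_triple_top a b c : (b < a)%N -> (c < a)%N ->
  let g := triple_commutator (L a) (L b) (L c) in
  g != 0 /\ lmonom g = FMonom [:: a; b; c].
Proof.
move=> ba ca g.
have -> : g = 1 *: mword K [:: a; b; c]
    + (- mword K [:: b; a; c] - (mword K [:: c; a; b] - mword K [:: c; b; a])).
  rewrite scale1r addrA.
  exact: (triple_commutator_expansion (@mwordM K N)).
apply: lmonom_below; first exact: oner_neq0.
apply: belowD; first by apply/belowN/below_mword/word_lt_head.
apply/belowN/belowD; first exact/below_mword/word_lt_head.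
exact/belowN/below_mword/word_lt_head.
Qed.

Lemma lmonom_triple_double a c : (c < a)%N ->
  let g := triple_commutator (L a) (L c) (L a) in
  g != 0 /\ lmonom g = FMonom [:: a; a; c].
Proof.
move=> ca g.
have -> : g = (- 1) *: mword K [:: a; a; c]
    + (mword K [:: a; c; a] - mword K [:: c; a; a] + mword K [:: a; c; a]).
  rewrite scaleN1r.
  exact: (double_commutator_expansion (@mwordM K N)).
apply: lmonom_below; first by rewrite oppr_eq0 oner_neq0.
have laca : below [:: a; a; c] (mword K [:: a; c; a]).
  by apply: below_mword; apply: word_lt_cons; apply: word_lt_head.
apply: belowD => //; apply: belowD => //; apply: belowN.
by apply: below_mword; apply: word_lt_head.
Qed.

(** If t < x, the words of the second product start with t or y, below x. If t = x
    the two products coincide, and the leading coefficient is 2. *)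
Lemma lmonom_latyshev x y z t q :
  (y < x)%N -> (t < z)%N -> (t <= x)%N ->
  let g := latyshev_poly (L y) (L x) (L t) (L z) (mword K q) in
  g != 0 /\ lmonom g = FMonom (x :: y :: q ++ [:: z; t]).
Proof.
move=> yx tz tx g; set w := x :: y :: q ++ [:: z; t].
have sz u v : size u = size v -> size (q ++ u) = size (q ++ v).
  by rewrite !size_cat => ->.
pose r := mword K (y :: x :: q ++ [:: t; z]) - mword K (y :: x :: q ++ [:: z; t])
          - mword K (x :: y :: q ++ [:: t; z]).
have rw : below w r.
  apply: belowD; last first.
    apply/belowN/below_mword; do 2! apply: word_lt_cons.
    by apply: word_lt_cat; apply: word_lt_head.
  apply: belowD; last apply: belowN; apply: below_mword; apply: word_lt_head => //=.
  by congr _.+1; apply: sz.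
have first_pair : commutator (L y) (L x) * mword K q
    * commutator (L t) (L z) = mword K w + r.
  exact: (commutator_pair_expansion (@mwordM K N)).
have [etx|ntx] := eqVneq t x.
  have -> : g = 2%:R *: mword K w + r *+ 2.
    rewrite scaler_nat -mulrnDl -first_pair mulr2n /g etx.
    by [].
  by apply: lmonom_below => //; rewrite mulr2n; apply: belowD.
have ltx : (t < x)%N.
  by rewrite ltn_neqAle tx andbT; apply: contraNneq ntx => /val_inj ->.
have -> : g = 1 *: mword K w + (r + commutator (L y) (L t) * mword K q
    * commutator (L x) (L z)).
  by rewrite scale1r addrA -first_pair.
apply: lmonom_below; first exact: oner_neq0.
apply: belowD => //.
have -> : commutator (L y) (L t) * mword K q
    * commutator (L x) (L z) =
    mword K (t :: y :: q ++ [:: z; x]) + (mword K (y :: t :: q ++ [:: x; z])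
    - mword K (y :: t :: q ++ [:: z; x]) - mword K (t :: y :: q ++ [:: x; z])).
  exact: (commutator_pair_expansion (@mwordM K N)).
have small (d e : alphabet N) u : (d < x)%N -> size u = 2%N ->
    below w (mword K (d :: e :: q ++ u)).
  by move=> dx su; apply/below_mword/word_lt_head => //=; congr _.+1; apply: sz.
apply: belowD; first exact: small.
apply: belowD; last by apply/belowN/small.
by apply: belowD; [|apply: belowN]; apply: small.
Qed.

Lemma obstruction_S_image u : obstruction u ->
  exists g, [/\ S_image (@S_endo K N) (@S_basis K N) g, g != 0 & lmonom g = FMonom u].
Proof.
case=> {u} [a c ca|a b c ba ca|x y q z t yx tz tx srt].
- have [] := lmonom_triple_double ca.
  by exists (triple_commutator (L a) (L c) (L a)); split=> //;
    exact: S_image_triple.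
- have [] := lmonom_triple_top ba ca.
  by exists (triple_commutator (L a) (L b) (L c)); split=> //;
    exact: S_image_triple.
have [g0 lg] := lmonom_latyshev q yx tz tx.
by exists (latyshev_poly (L y) (L x) (L t) (L z)
     (mword K q)); split=> //; exact: S_image_latyshev.
Qed.

Lemma S_basis_T_ideal : @S_basis K N `<=` @T_ideal_comm3 K N.
Proof.
by move=> _ [->|->]; [exact: T_ideal_commutator3 | exact: T_ideal_latyshev].
Qed.

(** * The Groebner S-basis *)

Lemma S_image_groebner :
  groebner_basis (@T_ideal_comm3 K N) (S_image (@S_endo K N) (@S_basis K N)).
Proof.
split; first exact: T_ideal_two_sided.
  move=> _ [phi _ [g Gg <-]]; apply: T_ideal_endo; exact: S_basis_T_ideal.
move=> f If f0; have nn := T_ideal_lmonom_not_normal two If f0.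
have [//|[u ou uf]] := normal_or_obstruction (lmonom f).
have [g [Sg g0 lg]] := obstruction_S_image ou.
by exists g; rewrite lg.
Qed.

Lemma S_image_groebner_S_basis :
  groebner_S_basis (@S_endo K N) (@T_ideal_comm3 K N) (@S_basis K N).
Proof.
split; [|exact: S_basis_T_ideal|exact: S_image_groebner].
split; [exact: S_endo_subsemigroup|exact: S_endo_id|exact: T_ideal_two_sided|].
by move=> phi _ _ [f If <-]; apply: T_ideal_endo.
Qed.

Lemma lmonomN (f : free_algebra K N) : lmonom (- f) = lmonom f.
Proof. by rewrite /lmonom msuppN. Qed.

(** S(G) contains both g = [[x_2, x_1], x_1] and - g = [[x_1, x_2], x_1], which have
    the same leading monomial. *)
Lemma S_image_not_minimal :
  ~ minimal_groebner_basis (@T_ideal_comm3 K N) (S_image (@S_endo K N) (@S_basis K N)).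
Proof.
have h1 : in_alphabet N 1 by exact: in_alphabet5.
have h2 : in_alphabet N 2 by exact: in_alphabet5.
have [g0 _] := @lmonom_triple_top (Alphabet h2) (Alphabet h1) (Alphabet h1) isT isT.
set g := triple_commutator _ _ _ in g0.
have Sg : S_image (@S_endo K N) (@S_basis K N) g by exact: S_image_triple.
have SNg : S_image (@S_endo K N) (@S_basis K N) (- g).
  have -> : - g = triple_commutator (L (Alphabet h1)) (L (Alphabet h2))
      (L (Alphabet h1)); last exact: S_image_triple.
  exact: opp_triple_commutator.
have gNg : - g <> g.
  move=> /eqP; rewrite eq_sym -subr_eq0 opprK -mulr2n -scaler_nat scaler_eq0.
  by rewrite (negPf two) (negPf g0).
case=> [[idl sub gb]] /(_ g Sg); apply; split=> // [h [Sh _]|f If f0]; first exact: sub.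
have [h [Sh h0 hf]] := gb f If f0.
have [ehg|nhg] := eqVneq h g; last by exists h; split=> //; split=> //; apply/eqP.
exists (- g); split=> //; first by rewrite oppr_eq0.
by rewrite lmonomN -ehg.
Qed.

End ObstructionImages.

Theorem theorem4p3 (K : fieldType) (N : option nat)
    (hK : 2%N \notin [pchar K])
    (hN : if N is Some n then (5 <= n)%N else true) :
  let x := var K N in
  let G := [set commutator (commutator (x 1%N) (x 2%N)) (x 3%N);
      commutator (x 1%N) (x 2%N) * x 5%N * commutator (x 3%N) (x 4%N)
      + commutator (x 1%N) (x 3%N) * x 5%N * commutator (x 2%N) (x 4%N)] in
  groebner_S_basis (@S_endo K N) (@T_ideal_comm3 K N) G /\
  ~ minimal_groebner_basis (@T_ideal_comm3 K N) (S_image (@S_endo K N) G).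
Proof.
have two : 2%:R != 0 :> K by move: hK; rewrite inE /=.
move=> x G; split; first exact: S_image_groebner_S_basis.
exact: S_image_not_minimal.
Qed.
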